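(* For $m\ge 1$ fixed and $n$ tending towards infinity, we have \[\min_{\mathcal{S}}\max_{\mathcal{G}}\mathbb{E}[C_{m,n}(\mathcal{G},\mathcal{S})]=\max_{\mathcal{G}}\mathbb{E}[C_{m,n}(\mathcal{G},\mathcal{S}_g)]\sim \log n,\] \[\max_{\mathcal{S}}\min_{\mathcal{G}}\mathbb{E}[C_{m,n}(\mathcal{G},\mathcal{S})]=\min_{\mathcal{G}}\mathbb{E}[C_{m,n}(\mathcal{G},\mathcal{S}_g)]\sim \Gamma\left(1+\frac{1}{m}\right)(m!)^{1/m}\cdot n^{-1/m},\] where the maxima and minima range over all Guesser strategies $\mathcal{G}$ and all Shuffler strategies $\mathcal{S}$.
   Context: For an integer $n\ge 1$, an $n$-vector is a vector $d=(d_1,\ldots,d_n)$ of non-negative integers ($d_i$ is the number of cards of type $i$ left in the deck), and $[n]=\{1,\dots,n\}$. Let $\mathrm{supp}(d)=\{i: d_i>0\}$, and let $\delta_i$ be the $n$-vector with a 1 in position $i$ and 0's elsewhere. A Guesser strategy $\mathcal{G}$ is a function assigning to each nonzero $n$-vector $d$ (for all $n$) a random variable $\mathcal{G}(d)$ with support in $[n]$. A Shuffler strategy $\mathcal{S}$ is a function assigning to each nonzero $n$-vector $d$ (for all $n$) a random variable $\mathcal{S}(d)$ with support in $\mathrm{supp}(d)$. Strategies matter only through the distributions of these random variables. In the game, the players choose simultaneously: in each round the choices of the two players are independent of each other, and (given the current deck) of all earlier rounds. The score is defined recursively by $C(d,\mathcal{G},\mathcal{S})=0$ if $d=(0,\ldots,0)$,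 and otherwise $C(d,\mathcal{G},\mathcal{S})=1_{\mathcal{S}(d)=\mathcal{G}(d)}+C(d-\delta_{\mathcal{S}(d)},\mathcal{G},\mathcal{S})$. For integers $m,n\ge1$, $C_{m,n}(\mathcal{G},\mathcal{S})=C(d,\mathcal{G},\mathcal{S})$ where $d=(m,\ldots,m)$ is the $n$-vector with all entries $m$ (the number of correct guesses in the Guesser-Shuffler game). The greedy strategy $\mathcal{S}_g$ is the Shuffler strategy with $\Pr[\mathcal{S}_g(d)=i]=|\mathrm{supp}(d)|^{-1}$ for all $i\in\mathrm{supp}(d)$. Here $\log$ is the natural logarithm, $\Gamma$ is the gamma function, and $a_n\sim b_n$ means $a_n/b_n\to1$ as $n\to\infty$. *)

(* Defs.v *)
From mathcomp Require Import all_boot all_order all_algebra.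
From mathcomp Require Import all_classical all_reals all_analysis.
Import numFieldNormedType.Exports.
Import Order.TTheory GRing.Theory Num.Theory.

Set Implicit Arguments.
Unset Strict Implicit.
Unset Printing Implicit Defensive.

Local Open Scope classical_set_scope.
Local Open Scope ring_scope.

(* d i is the number of cards of type i left in the deck d; the n card types
   are numbered from 0. *)
Definition deck (n : nat) := {ffun 'I_n -> nat}.

Definition empty_deck (n : nat) : deck n := [ffun => 0%N].

Definition full_deck (m n : nat) : deck n := [ffun => m].

Definition deck_size (n : nat) (d : deck n) : nat := (\sum_i d i)%N.

Definition supp (n : nat) (d : deck n) : {set 'I_n} :=
  [set i | (0 < d i)%N]%SET.

Definition remove_card (n : nat) (d : deck n) (i : 'I_n) : deck n :=
  [ffun j => (d j - (j == i))%N].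

Definition is_pmf (R : realType) (T : finType) (p : T -> R) : Prop :=
  (forall x, 0 <= p x) /\ \sum_x p x = 1.

(* A strategy is given by the distributions of its random variables:
   guess G d i is Pr[G(d) = i].  On the empty deck, where a strategy
   has no value, the function is unconstrained and plays no role. *)
Record guesser (R : realType) := Guesser {
  guess :> forall n : nat, deck n -> 'I_n -> R;
  guess_pmf : forall (n : nat) (d : deck n),
    d != empty_deck n -> is_pmf (guess d) }.

Record shuffler (R : realType) := Shuffler {
  shuffle :> forall n : nat, deck n -> 'I_n -> R;
  shuffle_pmf : forall (n : nat) (d : deck n),
    d != empty_deck n -> is_pmf (shuffle d);
  shuffle_supp : forall (n : nat) (d : deck n) (i : 'I_n),
    d != empty_deck n -> i \notin supp d -> shuffle d i = 0 }.

Definition greedy_fun (R : realType) (n : nat) (d : deck n) (i : 'I_n) : R :=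
  if i \in supp d then #|supp d|%:R^-1 else 0.

Lemma greedy_pmf (R : realType) (n : nat) (d : deck n) :
  d != empty_deck n -> is_pmf (@greedy_fun R n d).
Proof.
move=> d0; split=> [i|].
  by rewrite /greedy_fun; case: ifP => // _; rewrite invr_ge0.
rewrite -big_mkcond /= sumr_const -[LHS]mulr_natr mulVf//.
rewrite pnatr_eq0 -lt0n card_gt0; apply: contra d0 => /eqP s0.
apply/eqP/ffunP => i; rewrite ffunE; apply/eqP; rewrite -leqn0 leqNgt.
by have := finset.in_set0 i; rewrite -s0 finset.inE => ->.
Qed.

Lemma greedy_supp (R : realType) (n : nat) (d : deck n) (i : 'I_n) :
  d != empty_deck n -> i \notin supp d -> greedy_fun R d i = 0.
Proof. by move=> _ /negbTE; rewrite /greedy_fun => ->. Qed.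

Definition greedy (R : realType) : shuffler R :=
  Shuffler (@greedy_pmf R) (@greedy_supp R).

(* A play is the sequence of the outcomes (guess, card drawn) of the rounds.
   score d t is the value of C(d, G, S) on the play t. *)
Fixpoint score (n : nat) (d : deck n) (t : seq ('I_n * 'I_n)) : nat :=
  if d == empty_deck n then 0%N else
  if t is (g, s) :: t' then ((g == s) + score (remove_card d s) t')%N else 0%N.

(* In each round the two choices are independent of each other and, given the
   current deck, of the previous rounds: probabilities multiply. *)
Fixpoint play_prob (R : realType) (G : guesser R) (S : shuffler R) (n : nat)
    (d : deck n) (t : seq ('I_n * 'I_n)) : R :=
  if t is (g, s) :: t' then
    G n d g * S n d s * play_prob G S (remove_card d s) t'
  else 1.

(* A game from the deck d lasts exactly deck_size d rounds. *)
Definition expected_score (R : realType) (G : guesser R) (S : shuffler R)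
    (n : nat) (d : deck n) : R :=
  \sum_(t : (deck_size d).-tuple ('I_n * 'I_n))
    play_prob G S d t * (score d t)%:R.

Definition EC (R : realType) (m n : nat) (G : guesser R) (S : shuffler R) : R :=
  expected_score G S (full_deck m n).

Definition is_max (R : realType) (A : set R) (v : R) : Prop :=
  A v /\ ubound A v.

Definition is_min (R : realType) (A : set R) (v : R) : Prop :=
  A v /\ lbound A v.

Definition is_max_guesser (R : realType) (m n : nat) (S : shuffler R) (v : R) :=
  is_max (range (fun G : guesser R => EC m n G S)) v.

Definition is_min_guesser (R : realType) (m n : nat) (S : shuffler R) (v : R) :=
  is_min (range (fun G : guesser R => EC m n G S)) v.

(* v = min_S max_G E[C_{m,n}(G, S)], all the extrema being attained; f S is the
   inner maximum. *)
Definition is_minmax (R : realType) (m n : nat) (v : R) : Prop :=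
  exists f : shuffler R -> R,
    (forall S, is_max_guesser m n S (f S)) /\ is_min (range f) v.

Definition is_maxmin (R : realType) (m n : nat) (v : R) : Prop :=
  exists f : shuffler R -> R,
    (forall S, is_min_guesser m n S (f S)) /\ is_max (range f) v.

Definition Gamma (R : realType) (x : R) : R :=
  Rintegral lebesgue_measure `]0, +oo[
    (fun t : R => t `^ (x - 1) * expR (- t)).

Definition asymp_equiv (R : realType) (a b : nat -> R) : Prop :=
  a n / b n @[n --> \oo] --> (1 : R).

(* Main.v *)
(* If every card type carries an independent rate-1 Poisson clock and loses a
   card at each ring, then the sequence of cards drawn is that of the greedy
   Shuffler, and a round played with k types alive lasts 1/k on average.  With
   T_i the extinction time of type i, a Gamma(d_i) variable, the greedy Shuffler
   thus yields E[max_i T_i] to the best Guesser and E[min_i T_i] to the worst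
   one: the latter guesses a missing type as soon as there is one.  Both values
   V increase with the deck, so V(d) - V(d - delta_i) are the weights of a
   Guesser strategy (to be used, in the second case, while no type is missing)
   which earns exactly V(d) against every Shuffler; this is the saddle point.
   For n Gamma(m) variables, the maximum is about log n, and
   P(min > t) is about exp(- n t^m / m!) for small t, which integrates to
   Gamma(1 + 1/m) (n / m!)^(-1/m). *)
Require Import Defs.
From mathcomp Require Import all_boot all_order all_algebra.
From mathcomp Require Import all_classical all_reals all_analysis.
From mathcomp Require Import measurable_realfun ring lra.
Import numFieldNormedType.Exports.
Import Order.TTheory GRing.Theory Num.Theory.

Set Implicit Arguments.
Unset Strict Implicit.
Unset Printing Implicit Defensive.

Local Open Scope classical_set_scope.
Local Open Scope ring_scope.

(** * The expected score *)

Lemma empty_deckP n (d : deck n) : reflect (supp d = finset.set0) (d == empty_deck n).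
Proof.
apply: (iffP eqP) => [->|s0].
  by apply/setP => i; rewrite !finset.inE ffunE.
apply/ffunP => i; rewrite ffunE; apply/eqP; rewrite -leqn0 leqNgt.
by have := finset.in_set0 i; rewrite -s0 finset.inE => ->.
Qed.

Lemma supp_gt0 n (d : deck n) i : (i \in supp d) = (0 < d i)%N.
Proof. by rewrite finset.inE. Qed.

Lemma card_supp_gt0 n (d : deck n) : d != empty_deck n -> (0 < #|supp d|)%N.
Proof. by move=> d0; rewrite card_gt0; apply: contra d0 => /eqP/empty_deckP. Qed.

Lemma deck_size_empty n : deck_size (empty_deck n) = 0%N.
Proof. by rewrite /deck_size big1// => i _; rewrite ffunE. Qed.

Lemma deck_size_remove n (d : deck n) i : i \in supp d ->
  deck_size d = (deck_size (remove_card d i)).+1.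
Proof.
rewrite supp_gt0 => di; rewrite /deck_size (bigD1 i)//= [in RHS](bigD1 i)//=.
rewrite ffunE eqxx -addSn -subSn// subn1/=; congr addn.
by apply: eq_bigr => j /negbTE ji; rewrite ffunE ji subn0.
Qed.

Lemma deck_ind n (P : deck n -> Prop) :
  P (empty_deck n) ->
  (forall d, d != empty_deck n ->
     (forall i, i \in supp d -> P (remove_card d i)) -> P d) ->
  forall d, P d.
Proof.
move=> P0 PS d; have [k] := ubnP (deck_size d).
elim: k d => // k IH d dk; have [->//|d0] := eqVneq d (empty_deck n).
apply: PS => // i id; apply: IH.
by move: dk; rewrite (deck_size_remove id).
Qed.

Lemma big_tuple_cons (V : nmodType) (T : finType) k (F : k.+1.-tuple T -> V) :
  \sum_t F t = \sum_x \sum_(t : k.-tuple T) F [tuple of x :: t].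
Proof.
rewrite pair_big/= (reindex (fun p : T * k.-tuple T => [tuple of p.1 :: p.2]))//=.
exists (fun t : k.+1.-tuple T => (thead t, [tuple of behead t])) => [[x t]|t] _ /=.
  by congr pair; apply: val_inj.
by rewrite [in RHS](tuple_eta t).
Qed.

Section expected_score.
Variables (R : realType) (G : guesser R) (S : shuffler R) (n : nat).
Implicit Types d : deck n.

(** The length [k] and the payoff [f] are free so that one round can be split off; [expected_score]
    has [k = deck_size d] and the score as [f]. *)
Definition play_mean k d (f : seq ('I_n * 'I_n) -> R) : R :=
  \sum_(t : k.-tuple ('I_n * 'I_n)) play_prob G S d t * f t.

Lemma play_mean0 d f : play_mean 0 d f = f [::].
Proof.
rewrite /play_mean (big_pred1 [tuple]) ?mul1r// => t.
by rewrite [t]tuple0/=; apply/esym/eqP/val_inj.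
Qed.

Lemma play_meanS k d f :
  play_mean k.+1 d f = \sum_s S n d s * \sum_g G n d g *
    play_mean k (remove_card d s) (fun t => f ((g, s) :: t)).
Proof.

under [RHS]eq_bigr => s _ do rewrite mulr_sumr.
rewrite exchange_big pair_bigA /play_mean big_tuple_cons/=.
apply: eq_bigr => -[g s] _ /=; rewrite mulrA [S n d s * _]mulrC mulr_sumr.
by apply: eq_bigr => t _; rewrite !mulrA.
Qed.

(** Total probability is 1. All possible draws lead to decks of the same size, and impossible draws
    have weight 0. *)
Lemma play_mean_cst d c : play_mean (deck_size d) d (fun=> c) = c.
Proof.
elim/deck_ind: d => [|d d0 IH]; first by rewrite deck_size_empty play_mean0.
have [i id] : exists i, i \in supp d by apply/card_gt0P; exact: card_supp_gt0.
rewrite (deck_size_remove id) play_meanS.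
transitivity (\sum_s S n d s * c); last first.
  by rewrite -mulr_suml (shuffle_pmf S d0).2 mul1r.
apply: eq_bigr => s _; have [sd|sd] := boolP (s \in supp d); last first.
  by rewrite (shuffle_supp S d0 sd) !mul0r.
have -> : deck_size (remove_card d i) = deck_size (remove_card d s).
  by apply: succn_inj; rewrite -!deck_size_remove.
by rewrite -mulr_suml (guess_pmf G d0).2 mul1r IH.
Qed.

Lemma expected_score_empty : expected_score G S (empty_deck n) = 0.
Proof.
by rewrite /expected_score big1// => t _; case: (tval t) => [|[? ?] ?]/=;
  rewrite eqxx mulr0.
Qed.

Lemma expected_score_rec d : d != empty_deck n ->
  expected_score G S d =
  \sum_s S n d s * (G n d s + expected_score G S (remove_card d s)).
Proof.
move=> d0.
have [i id] : exists i, i \in supp d by apply/card_gt0P; exact: card_supp_gt0.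
rewrite {1}/expected_score (deck_size_remove id).
rewrite -[LHS]/(play_mean (deck_size (remove_card d i)).+1 d (fun t => (score d t)%:R)).
rewrite play_meanS; apply: eq_bigr => s _.
have [sd|sd] := boolP (s \in supp d); last by rewrite (shuffle_supp S d0 sd) !mul0r.
have -> : deck_size (remove_card d i) = deck_size (remove_card d s).
  by apply: succn_inj; rewrite -!deck_size_remove.
congr (_ * _).
(* Averaging the indicator over the guess leaves [G n d s]. *)
transitivity (\sum_g (G n d g * (g == s)%:R +
                      G n d g * expected_score G S (remove_card d s))).
  apply: eq_bigr => g _; rewrite -mulrDr; congr (_ * _).
  rewrite -[in RHS](play_mean_cst (remove_card d s) (g == s)%:R).
  rewrite /play_mean /expected_score -big_split/=; apply: eq_bigr => t _.
  by rewrite (negbTE d0) natrD mulrDr.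
rewrite big_split/= -mulr_suml (guess_pmf G d0).2 mul1r; congr (_ + _).
by rewrite (bigD1 s)//= eqxx mulr1 big1 ?addr0// => g /negbTE ->; rewrite mulr0.
Qed.

End expected_score.

(** * Verification principles for the score recursion *)

Section comparison.
Variables (R : realType) (n : nat).
Implicit Types d : deck n.

Lemma shuffle_ge0 (S : shuffler R) d s : d != empty_deck n -> 0 <= S n d s.
Proof. by move=> /(shuffle_pmf S)[]. Qed.

Lemma guess_ge0 (G : guesser R) d s : d != empty_deck n -> 0 <= G n d s.
Proof. by move=> /(guess_pmf G)[]. Qed.

(** A subsolution of the recursion lies below its solution, so optimality of a strategy reduces to a
    one-step check. *)
Lemma expected_score_ge (G : guesser R) (S : shuffler R) (V : deck n -> R) :
  V (empty_deck n) <= 0 ->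
  (forall d, d != empty_deck n ->
     V d <= \sum_s S n d s * (G n d s + V (remove_card d s))) ->
  forall d, V d <= expected_score G S d.
Proof.
move=> V0 VS; elim/deck_ind => [|d d0 IH]; first by rewrite expected_score_empty.
rewrite expected_score_rec// (le_trans (VS _ d0))// ler_sum// => s _.
have [sd|sd] := boolP (s \in supp d); last by rewrite (shuffle_supp S d0 sd) !mul0r.
by rewrite ler_wpM2l ?shuffle_ge0// lerD2l IH.
Qed.

Lemma expected_score_le (G : guesser R) (S : shuffler R) (V : deck n -> R) :
  0 <= V (empty_deck n) ->
  (forall d, d != empty_deck n ->
     \sum_s S n d s * (G n d s + V (remove_card d s)) <= V d) ->
  forall d, expected_score G S d <= V d.
Proof.
move=> V0 VS; elim/deck_ind => [|d d0 IH]; first by rewrite expected_score_empty.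
rewrite expected_score_rec// (le_trans _ (VS _ d0))// ler_sum// => s _.
have [sd|sd] := boolP (s \in supp d); last by rewrite (shuffle_supp S d0 sd) !mul0r.
by rewrite ler_wpM2l ?shuffle_ge0// lerD2l IH.
Qed.

Lemma expected_score_eq (G : guesser R) (S : shuffler R) (V : deck n -> R) :
  V (empty_deck n) = 0 ->
  (forall d, d != empty_deck n ->
     \sum_s S n d s * (G n d s + V (remove_card d s)) = V d) ->
  forall d, expected_score G S d = V d.
Proof.
move=> V0 VS d; apply/eqP; rewrite eq_le; apply/andP; split.
- by apply: expected_score_le => [|d' d'0]; [rewrite V0|rewrite VS].
- by apply: expected_score_ge => [|d' d'0]; [rewrite V0|rewrite VS].
Qed.

End comparison.

(** * Optimal replies to a known Shuffler *)

Section pure_guesser.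
Variables (R : realType) (c : forall n, deck n -> option 'I_n).

Definition pure_guess n (d : deck n) (i : 'I_n) : R :=
  if c d is Some j then (i == j)%:R else n%:R^-1.

Lemma pure_guess_pmf n (d : deck n) :
  d != empty_deck n -> is_pmf (pure_guess d).
Proof.
move=> d0; rewrite /pure_guess; case: (c d) => [j|]; split => [i|].
- exact: ler0n.
- by rewrite (bigD1 j)//= eqxx big1 ?addr0// => i /negbTE ->.
- by rewrite invr_ge0.
- rewrite sumr_const card_ord -[LHS]mulr_natl divff// pnatr_eq0.
  by case: n d d0 => // d /eqP[]; apply/ffunP => -[].
Qed.

Definition pure_guesser : guesser R := Guesser pure_guess_pmf.

Lemma sum_pure (S : shuffler R) n (d : deck n) j (V : 'I_n -> R) : c d = Some j ->
  \sum_s S n d s * (pure_guesser n d s + V s) =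
  S n d j + \sum_s S n d s * V s.
Proof.
move=> cj; under eq_bigr do rewrite mulrDr; rewrite big_split/=; congr (_ + _).
rewrite (bigD1 j)//= /pure_guess cj eqxx mulr1 big1 ?addr0//.
by move=> i /negbTE ->; rewrite mulr0.
Qed.

End pure_guesser.

(** The expected immediate gain is an average, under the guess, of the Shuffler's probabilities. *)
Lemma sum_shuffle_le (R : realType) (G : guesser R) (S : shuffler R) n (d : deck n)
    (c : R) : d != empty_deck n -> (forall s, S n d s <= c) ->
  \sum_s S n d s * G n d s <= c.
Proof.
move=> d0 Sc; rewrite -[leRHS]mulr1 -(guess_pmf G d0).2 mulr_sumr ler_sum// => s _.
by rewrite ler_wpM2r// guess_ge0.
Qed.

Lemma sum_shuffle_ge (R : realType) (G : guesser R) (S : shuffler R) n (d : deck n)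
    (c : R) : d != empty_deck n -> (forall s, c <= S n d s) ->
  c <= \sum_s S n d s * G n d s.
Proof.
move=> d0 Sc; rewrite -[leLHS]mulr1 -(guess_pmf G d0).2 mulr_sumr ler_sum// => s _.
by rewrite ler_wpM2r// guess_ge0.
Qed.

Section best_response.
Variables (R : realType) (S : shuffler R).

Definition likeliest n (d : deck n) : option 'I_n :=
  [pick i | [forall j, S n d j <= S n d i]].

Definition unlikeliest n (d : deck n) : option 'I_n :=
  [pick i | [forall j, S n d i <= S n d j]].

Lemma likeliestP n (d : deck n) : d != empty_deck n ->
  exists2 i, likeliest d = Some i & forall j, S n d j <= S n d i.
Proof.
move=> d0; have /card_gt0P[i0 _] := card_supp_gt0 d0.
rewrite /likeliest; case: pickP => [i /forallP Si|/(_ [arg max_(i > i0) S n d i]%O)].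
  by exists i.
by case: arg_maxP => //= i _ Si /negP[]; apply/forallP => j; apply: Si.
Qed.

Lemma unlikeliestP n (d : deck n) : d != empty_deck n ->
  exists2 i, unlikeliest d = Some i & forall j, S n d i <= S n d j.
Proof.
move=> d0; have /card_gt0P[i0 _] := card_supp_gt0 d0.
rewrite /unlikeliest; case: pickP => [i /forallP Si|/(_ [arg min_(i < i0) S n d i]%O)].
  by exists i.
by case: arg_minP => //= i _ Si /negP[]; apply/forallP => j; apply: Si.
Qed.

(** A guess has no effect on the deck, so the best reply maximises the chance of success of each
    round separately. *)
Lemma is_max_guesser_likeliest m n :
  is_max_guesser m n S (EC m n (pure_guesser R likeliest) S).
Proof.
split; first by exists (pure_guesser R likeliest).
move=> _ [G _ <-]; apply: expected_score_le => [|d d0].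
  by rewrite expected_score_empty.
rewrite [leRHS]expected_score_rec//.
have [i ci Si] := likeliestP d0; rewrite (sum_pure _ _ ci).
by under eq_bigr do rewrite mulrDr; rewrite big_split/= lerD2r sum_shuffle_le.
Qed.

Lemma is_min_guesser_unlikeliest m n :
  is_min_guesser m n S (EC m n (pure_guesser R unlikeliest) S).
Proof.
split; first by exists (pure_guesser R unlikeliest).
move=> _ [G _ <-]; apply: expected_score_ge => [|d d0].
  by rewrite expected_score_empty.
rewrite [leLHS]expected_score_rec//.
have [i ci Si] := unlikeliestP d0; rewrite (sum_pure _ _ ci).
by under [leRHS]eq_bigr do rewrite mulrDr; rewrite big_split/= lerD2r sum_shuffle_ge.
Qed.

End best_response.

(** * The greedy Shuffler against the best Guesser *)

Lemma sum_greedy (R : realType) n (d : deck n) (F : 'I_n -> R) :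
  \sum_s greedy R n d s * F s = #|supp d|%:R^-1 * \sum_(s in supp d) F s.
Proof.
rewrite mulr_sumr [RHS]big_mkcond; apply: eq_bigr => s _ /=.
by rewrite /greedy_fun; case: ifP => // _; rewrite mul0r.
Qed.

(** Subtraction is truncated at 0; sums over all types may thus include absent ones, whose
    increments vanish. *)
Lemma remove_card_notin n (d : deck n) i : i \notin supp d -> remove_card d i = d.
Proof.
rewrite supp_gt0 -eqn0Ngt => /eqP di; apply/ffunP => j; rewrite ffunE.
by case: eqP => [->|_]; rewrite ?di// subn0.
Qed.

Lemma remove_cardC n (d : deck n) i j :
  remove_card (remove_card d i) j = remove_card (remove_card d j) i.
Proof. by apply/ffunP => k; rewrite !ffunE subnAC. Qed.

Lemma supp_remove_card n (d : deck n) i :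
  supp (remove_card d i) = if d i == 1%N then supp d :\ i else supp d.
Proof.
apply/setP => j; case: eqP => di; rewrite !finset.inE ffunE.
  by case: (eqVneq j i) => [->|_] //=; rewrite ?di// subn0.
case: (eqVneq j i) => [->|_]; last by rewrite subn0.
by case: (d i) di => [|[]].
Qed.

Lemma supp_remove_card_sub n (d : deck n) i : supp (remove_card d i) \subset supp d.
Proof. by rewrite supp_remove_card; case: ifP => // _; exact: subD1set. Qed.

Section greedy_max.
Variable R : realType.

Definition max_score n (d : deck n) : R :=
  expected_score (pure_guesser R (likeliest (greedy R))) (greedy R) d.

Lemma max_score_empty n : max_score (empty_deck n) = 0.
Proof. exact: expected_score_empty. Qed.

Lemma max_score_rec n (d : deck n) : d != empty_deck n ->
  #|supp d|%:R * max_score d = 1 + \sum_(s in supp d) max_score (remove_card d s).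
Proof.
move=> d0; have k0 : #|supp d|%:R != 0 :> R.
  by rewrite pnatr_eq0 -lt0n card_supp_gt0.
rewrite /max_score expected_score_rec//.
have [i ci Si] := likeliestP (greedy R) d0.
rewrite (sum_pure _ _ ci) sum_greedy mulrDr mulVKf//; congr (_ + _).
suff -> : greedy R n d i = #|supp d|%:R^-1 by rewrite divff.
(* A likeliest type has cards: outside the support the probability is 0, which cannot dominate the
   positive weight of some [j]. *)
rewrite /= /greedy_fun; case: ifPn => // id.
have /card_gt0P[j jd] := card_supp_gt0 d0.
have := Si j; rewrite /= /greedy_fun jd (negbTE id) => k_le0.
by apply/le_anti; rewrite k_le0 invr_ge0 ler0n.
Qed.

Lemma max_score_ge0 n (d : deck n) : 0 <= max_score d.
Proof.
elim/deck_ind: d => [|d d0 IH]; first by rewrite max_score_empty.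
have k0 : 0 < #|supp d|%:R :> R by rewrite ltr0n card_supp_gt0.
by rewrite -(pmulr_rge0 _ k0) max_score_rec// addr_ge0// sumr_ge0.
Qed.

(** The recursions of both decks are compared term by term. If the last card of type [i] goes, the
    support shrinks by one, and the extra term [max_score (remove_card d i)] occurs on both
    sides. *)
Lemma le_max_score_remove n (d : deck n) i : max_score (remove_card d i) <= max_score d.
Proof.
have [|id] := boolP (i \in supp d); last by rewrite remove_card_notin.
elim/deck_ind: d i => [|d d0 IH] i id; first by move: id; rewrite supp_gt0 ffunE.
have k0 : 0 < #|supp d|%:R :> R by rewrite ltr0n card_supp_gt0.
have [->|d'0] := eqVneq (remove_card d i) (empty_deck n).
  by rewrite max_score_empty max_score_ge0.
(* The side condition says that type [i] still has a card once one of type [j] is removed. *)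
have IH' j : i != j \/ d i != 1%N -> j \in supp d ->
    max_score (remove_card (remove_card d i) j) <= max_score (remove_card d j).
  move=> ij jd; rewrite remove_cardC IH// supp_gt0 ffunE subn_gt0.
  move: id ij; rewrite supp_gt0; case: (eqVneq i j) => //= _.
  by move=> di [//|]; case: (d i) di => [|[]].
rewrite -(ler_pM2l k0) [leRHS]max_score_rec//.
have := max_score_rec d'0; rewrite supp_remove_card.
case: (eqVneq (d i) 1%N) => [di|di] => [d'E|->]; last first.
  by rewrite lerD2l ler_sum// => j jd; rewrite IH'//; right.
rewrite (cardsD1 i (supp d)) id natrD mulrDl mul1r d'E.
rewrite [in leRHS](big_setD1 i)//= addrCA !lerD2l ler_sum// => j.
by rewrite finset.in_setD1 eq_sym => /andP[ij jd]; rewrite IH'//; left.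
Qed.

(* The Guesser makes the Shuffler indifferent; a type i without cards gets
   weight 0, since then remove_card d i = d. *)
Definition max_guess n (d : deck n) (i : 'I_n) : R :=
  max_score d - max_score (remove_card d i).

Lemma max_guess_pmf n (d : deck n) : d != empty_deck n -> is_pmf (max_guess d).
Proof.
move=> d0; split=> [i|]; first by rewrite subr_ge0 le_max_score_remove.
rewrite (bigID (mem (supp d)))/= [X in _ + X]big1 ?addr0 => [|i id]; last first.
  by rewrite /max_guess remove_card_notin// subrr.
by rewrite sumrB sumr_const -[X in X - _]mulr_natl max_score_rec// addrK.
Qed.

Definition max_guesser : guesser R := Guesser max_guess_pmf.

(** Whatever card is drawn, the gain and the continuation telescope to [max_score d]. *)
Lemma max_guesser_score (S : shuffler R) n (d : deck n) :
  expected_score max_guesser S d = max_score d.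
Proof.
apply: expected_score_eq => [|{}d d0]; first exact: max_score_empty.
under eq_bigr do rewrite /= /max_guess subrK.
by rewrite -mulr_suml (shuffle_pmf S d0).2 mul1r.
Qed.

Lemma is_max_guesser_greedy m n :
  is_max_guesser m n (greedy R) (max_score (full_deck m n)).
Proof. exact: is_max_guesser_likeliest. Qed.

(** Against any Shuffler, [max_guesser] already secures this value; the greedy Shuffler concedes no
    more. *)
Lemma is_minmax_max_score m n : is_minmax m n (max_score (full_deck m n)).
Proof.
exists (fun S => EC m n (pure_guesser R (likeliest S)) S); split => [S|].
  exact: is_max_guesser_likeliest.
split; first by exists (greedy R).
move=> _ [S _ <-]; rewrite -(max_guesser_score S).
by apply: (is_max_guesser_likeliest S m n).2; exists max_guesser.
Qed.

(** After one removal at least [k - 1] of the [k] types remain, so induction gives [ln k]; the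
    recursion then only needs [ln ((k + 1) / k) <= 1 / k]. *)
Lemma le_ln_max_score n (d : deck n) : ln (#|supp d|.+1%:R) <= max_score d.
Proof.
elim/deck_ind: d => [|d d0 IH].
  by rewrite (empty_deckP _ (eqxx _)) cards0 ln1 max_score_ge0.
have kN0 := card_supp_gt0 d0; set k := #|supp d| in kN0 *.
have k0 : 0 < k%:R :> R by rewrite ltr0n.
rewrite -(ler_pM2l k0) max_score_rec// -/k.
have : \sum_(s in supp d) ln (k%:R : R) <=
    \sum_(s in supp d) max_score (remove_card d s).
  apply: ler_sum => s sd; apply: le_trans (IH s sd).
  rewrite ler_ln ?posrE ?ltr0n// ler_nat /k (cardsD1 s (supp d)) sd ltnS.
  rewrite supp_remove_card; case: ifP => // _.
  by rewrite subset_leq_card// subD1set.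
rewrite sumr_const -[X in X <= _]mulr_natl -/k => kln.
apply: le_trans (lerD (lexx 1) kln); rewrite -lerBlDr -mulrBr.
rewrite -ln_div ?posrE ?ltr0n// -addn1 natrD mulrDl divff ?gt_eqF// mul1r.
rewrite mulrC -ler_pdivlMr// mul1r le_ln1Dx//.
by apply: lt_trans (_ : 0 < _); rewrite ?ltrN10// invr_gt0.
Qed.

(* Discrete form of Jensen's inequality
   E[max_i T_i] <= (1/l) log (\sum_i E[exp (l T_i)]), where c = 1 / (1 - l):
   a Gamma(d_i) variable satisfies E[exp (l T_i)] = c ^ d_i. *)
Definition exp_weight (c : R) n (d : deck n) : R := \sum_(i in supp d) c ^+ d i.

Lemma exp_weight_ge0 c n (d : deck n) : 0 <= c -> 0 <= exp_weight c d.
Proof. by move=> c0; apply: sumr_ge0 => i _; rewrite exprn_ge0. Qed.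

Lemma exp_weight_ge c n (d : deck n) i : 0 <= c -> i \in supp d ->
  c ^+ d i <= exp_weight c d.
Proof.
move=> c0 id; rewrite /exp_weight (big_setD1 i)//= lerDl sumr_ge0// => j _.
exact: exprn_ge0.
Qed.

(** While type [i] survives, its term loses exactly the fraction [1 - c^-1]; the last card takes the
    whole term with it, which is more. *)
Lemma exp_weight_remove c n (d : deck n) i : 1 < c -> i \in supp d ->
  exp_weight c (remove_card d i) <= exp_weight c d - (1 - c^-1) * c ^+ d i.
Proof.
move=> c1 id; have c0 := lt_trans ltr01 c1.
rewrite [exp_weight c d]/exp_weight (big_setD1 i)//= addrAC mulrBl mul1r opprB.
rewrite addrCA subrr addr0 addrC /exp_weight supp_remove_card.
have dE j : j \in supp d :\ i -> c ^+ (remove_card d i) j = c ^+ d j.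
  by rewrite finset.in_setD1 => /andP[/negbTE ji _]; rewrite ffunE ji subn0.
case: ifP => di.
  by rewrite (eq_bigr _ dE) lerDl mulr_ge0 ?invr_ge0 ?exprn_ge0// ltW.
rewrite (big_setD1 i)//= (eq_bigr _ dE) addrC lerD2l ffunE eqxx.
move: id; rewrite supp_gt0; case: (d i) di => // k _ _.
by rewrite exprS mulKf ?gt_eqF// subn1.
Qed.

(** By [ln (1 - x) <= - x], removing [s] lowers the logarithm by at least
    [(1 - c^-1) * (c ^+ d s / w)]. These amounts sum to [1 - c^-1] over the support, which pays for
    the 1 in the recursion. *)
Lemma max_score_le_ln c n (d : deck n) : 1 < c ->
  (1 - c^-1) * max_score d <= ln (exp_weight c d).
Proof.
move=> c1; have c0 := lt_trans ltr01 c1.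
have l0 : 0 < 1 - c^-1 by rewrite subr_gt0 invf_lt1.
elim/deck_ind: d => [|d d0 IH].
  by rewrite max_score_empty mulr0 /exp_weight (empty_deckP _ (eqxx _)) big_set0 ln0.
have kN0 := card_supp_gt0 d0; set k := #|supp d| in kN0 *.
have k0 : 0 < k%:R :> R by rewrite ltr0n.
have [i0 i0d] : exists i, i \in supp d by apply/card_gt0P.
set w := exp_weight c d.
have cw i : i \in supp d -> c ^+ d i <= w by apply: exp_weight_ge; rewrite ltW.
have c_le_w : c <= w.
  apply: le_trans (cw _ i0d); rewrite -[leLHS]expr1 ler_weXn2l ?(ltW c1)//.
  by rewrite -supp_gt0.
have w0 := lt_le_trans c0 c_le_w.
rewrite -(ler_pM2l k0) mulrCA max_score_rec// mulrDr mulr1.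
suff lns s : s \in supp d ->
    ln (exp_weight c (remove_card d s)) <= ln w - (1 - c^-1) * (c ^+ d s / w).
  rewrite mulr_sumr -lerBrDl.
  apply: (@le_trans _ _ (\sum_(s in supp d) (ln w - (1 - c^-1) * (c ^+ d s / w)))).
    by apply: ler_sum => s sd; exact: le_trans (IH s sd) (lns s sd).
  rewrite sumrB sumr_const -[X in X - _ <= _]mulr_natl -mulr_sumr -mulr_suml.
  by rewrite -/(exp_weight c d) -/w divff ?mulr1 ?gt_eqF.
move=> sd; have := exp_weight_remove c1 sd; rewrite -/w.
have := exp_weight_ge0 (remove_card d s) (ltW c0).
(* When no card is left, [ln 0 = 0] by convention, and the claim follows from
   [1 - c^-1 <= ln c <= ln w]. *)
rewrite le_eqVlt => /predU1P[<- _|w'0 w'w].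
  rewrite ln0// subr_ge0 (@le_trans _ _ (1 - c^-1))//.
    by rewrite ger_pMr// ler_pdivrMr// mul1r cw.
  rewrite (@le_trans _ _ (ln c))// ?ler_ln//.
  rewrite -lerN2 -lnV ?posrE// opprB -[X in ln X](addrNK 1) addrC le_ln1Dx//.
  by rewrite ltrBrDl subrr invr_gt0.
set x := (1 - c^-1) * (c ^+ d s / w).
have wx : w - (1 - c^-1) * c ^+ d s = w * (1 - x).
  by rewrite mulrBr mulr1 /x [in RHS]mulrCA [w * _]mulrC divfK ?gt_eqF.
rewrite wx in w'w; have x1 : 0 < 1 - x by rewrite -(pmulr_rgt0 _ w0) (lt_le_trans w'0).
have : ln (exp_weight c (remove_card d s)) <= ln (w * (1 - x)).
  by rewrite ler_ln ?posrE// mulr_gt0.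
move/le_trans; apply; rewrite lnM ?posrE// lerD2l le_ln1Dx//.
by rewrite ltrNl opprK -subr_gt0.
Qed.

End greedy_max.

Lemma full_deck_supp m n : (0 < m)%N -> supp (full_deck m n) = [set: 'I_n]%SET.
Proof. by move=> m0; apply/setP => i; rewrite !finset.inE ffunE m0. Qed.

Lemma max_score_full_asymp (R : realType) m : (0 < m)%N ->
  asymp_equiv (fun n => max_score R (full_deck m n)) (fun n => ln n%:R).
Proof.
move=> m0; apply/cvgrPdist_le => e e0.
(* The upper bound has leading factor [(1 - c^-1)^-1]; [c] is tuned so that it uses half of the
   tolerance [e]. *)
have [c c1 ce] : exists2 c : R, 1 < c & (1 - c^-1)^-1 = 1 + e / 2.
  exists (1 + 2 / e); first by rewrite ltrDl divr_gt0.
  field; rewrite (addrC e 2) addrK; apply/and3P; split; apply: lt0r_neq0; lra.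
have c0 := lt_trans ltr01 c1.
have l0 : 0 < 1 - c^-1 by rewrite subr_gt0 invf_lt1 ?(lt_trans ltr01).
have lny : ln n%:R @[n --> \oo] --> (+oo : set_system R).
  apply/cvgryPge => A; near=> n; rewrite -[A]expRK ler_ln ?posrE ?expR_gt0//.
    by near: n; exact: nbhs_infty_ger.
  by near: n; exact: nbhs_infty_gtr.
near=> n.
have ln0 : 0 < ln n%:R :> R.
  by near: n; move/cvgryPgt: lny => /(_ 0).
have n0 : 0 < n%:R :> R.
  rewrite (lt_le_trans ltr01)// leNgt; apply/negP => /ltW/ln_le0.
  by rewrite leNgt ln0.
have lb : ln n%:R <= max_score R (full_deck m n).
  apply: le_trans (le_ln_max_score _ _); rewrite full_deck_supp// cardsT card_ord.
  by rewrite ler_ln ?posrE// ler_nat.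
have := max_score_le_ln (full_deck m n) c1.
rewrite /exp_weight full_deck_supp//.
under eq_bigr do rewrite ffunE.
rewrite sumr_const cardsT card_ord -[c ^+ m *+ n]mulr_natl lnM ?posrE ?exprn_gt0//.
rewrite mulrC -ler_pdivlMr// ce lnXn// => ub.
rewrite distrC ger0_norm; last by rewrite subr_ge0 ler_pdivlMr// mul1r.
rewrite lerBlDr ler_pdivrMr//; apply: (le_trans ub).
(* The other half of [e] absorbs the contribution of [ln (c ^+ m)], which does not grow with [n]. *)
have -> : (e + 1) * ln n%:R = ln n%:R * (1 + e / 2) + ln n%:R * (e / 2).
  by field.
rewrite mulrDl lerD2l -ler_pdivrMr ?divr_gt0//.
by near: n; move/cvgryPge: lny; apply.
Unshelve. all: by end_near. Qed.

(** * The greedy Shuffler against the worst Guesser *)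

Section greedy_min.
Variable R : realType.

Definition min_score n (d : deck n) : R :=
  expected_score (pure_guesser R (unlikeliest (greedy R))) (greedy R) d.

Lemma min_score_empty n : min_score (empty_deck n) = 0.
Proof. exact: expected_score_empty. Qed.

(** The greedy Shuffler never draws a missing type, so the least likely guess never succeeds, and a
    missing type stays missing. *)
Lemma min_score_eq0 n (d : deck n) i : i \notin supp d -> min_score d = 0.
Proof.
elim/deck_ind: d => [|d d0 IH] id; first exact: min_score_empty.
rewrite /min_score expected_score_rec//.
have [j cj Sj] := unlikeliestP (greedy R) d0.
rewrite (sum_pure _ _ cj) sum_greedy big1 ?mulr0 ?addr0 => [|s sd].
  have := Sj i; rewrite [X in _ <= X](shuffle_supp (greedy R) d0 id) => Sj0.
  by apply/le_anti; rewrite Sj0 shuffle_ge0.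
apply: IH => //; apply: contra id.
exact: (fintype.subsetP (supp_remove_card_sub _ _)).
Qed.

Lemma min_score_rec n (d : deck n) : d != empty_deck n -> supp d = [set: 'I_n]%SET ->
  n%:R * min_score d = 1 + \sum_s min_score (remove_card d s).
Proof.
move=> d0 dT; have n0 : n%:R != 0 :> R.
  by have := card_supp_gt0 d0; rewrite dT cardsT card_ord pnatr_eq0 lt0n.
rewrite /min_score expected_score_rec//.
have [i ci Si] := unlikeliestP (greedy R) d0.
rewrite (sum_pure _ _ ci) sum_greedy dT cardsT card_ord mulrDr mulVKf//; congr (_ + _).
  by rewrite /= /greedy_fun dT finset.inE cardsT card_ord divff.
by apply: eq_bigl => s; rewrite finset.inE.
Qed.

Lemma min_score_ge0 n (d : deck n) : 0 <= min_score d.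
Proof.
apply: (expected_score_ge (V := fun=> 0)) => // {}d d0.
by apply: sumr_ge0 => s _; rewrite addr0 mulr_ge0 ?shuffle_ge0 ?guess_ge0.
Qed.

(** Either the smaller deck lacks a type and scores 0, or both decks have full support and their
    recursions share the factor [n]. *)
Lemma le_min_score_remove n (d : deck n) i : min_score (remove_card d i) <= min_score d.
Proof.
elim/deck_ind: d i => [|d d0 IH] i.
  by rewrite remove_card_notin// supp_gt0 ffunE.
have [/eqP d'T|] := boolP (supp (remove_card d i) == [set: 'I_n]%SET); last first.
  rewrite finset.eqEsubset finset.subsetT/= => /fintype.subsetPn[j _ jd'].
  by rewrite (min_score_eq0 jd') min_score_ge0.
have dT : supp d = [set: 'I_n]%SET.
  by apply/eqP; rewrite finset.eqEsubset finset.subsetT -d'T supp_remove_card_sub.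
have n0 : 0 < n%:R :> R by rewrite ltr0n (leq_ltn_trans _ (ltn_ord i)).
have d'0 : remove_card d i != empty_deck n.
  by apply/empty_deckP => d'0; have := finset.in_setT i; rewrite -d'T d'0 finset.inE.
rewrite -(ler_pM2l n0) !min_score_rec// lerD2l ler_sum// => j _.
by rewrite remove_cardC IH// dT finset.inE.
Qed.

Definition min_guess n (d : deck n) (i : 'I_n) : R :=
  if [pick j | j \notin supp d] is Some j then (i == j)%:R
  else min_score d - min_score (remove_card d i).

Lemma min_guess_pmf n (d : deck n) : d != empty_deck n -> is_pmf (min_guess d).
Proof.
move=> d0; rewrite /min_guess; case: pickP => [j jd|dT].
  split=> [i|]; first exact: ler0n.
  by rewrite (bigD1 j)//= eqxx big1 ?addr0// => i /negbTE ->.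
split=> [i|]; first by rewrite subr_ge0 le_min_score_remove.
rewrite sumrB sumr_const card_ord -[X in X - _]mulr_natl min_score_rec// ?addrK//.
by apply/setP => i; have /negbFE := dT i; rewrite [in RHS]finset.inE.
Qed.

Definition min_guesser : guesser R := Guesser min_guess_pmf.

Lemma min_guesser_score (S : shuffler R) n (d : deck n) :
  expected_score min_guesser S d = min_score d.
Proof.
apply: expected_score_eq => [|{}d d0]; first exact: min_score_empty.
rewrite /= /min_guess; case: pickP => [j jd|dT].
  rewrite (min_score_eq0 jd) big1// => s _.
  rewrite (@min_score_eq0 _ _ j) ?addr0; last first.
    by apply: contra jd; apply: (fintype.subsetP (supp_remove_card_sub _ _)).
  by case: eqVneq => [->|_]; rewrite ?mulr0// (shuffle_supp S d0 jd) mul0r.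
under eq_bigr do rewrite subrK.
by rewrite -mulr_suml (shuffle_pmf S d0).2 mul1r.
Qed.

Lemma is_min_guesser_greedy m n :
  is_min_guesser m n (greedy R) (min_score (full_deck m n)).
Proof. exact: is_min_guesser_unlikeliest. Qed.

(** Against any Shuffler, [min_guesser] holds the score to this value; the greedy Shuffler
    guarantees it. *)
Lemma is_maxmin_min_score m n : is_maxmin m n (min_score (full_deck m n)).
Proof.
exists (fun S => EC m n (pure_guesser R (unlikeliest S)) S); split => [S|].
  exact: is_min_guesser_unlikeliest.
split; first by exists (greedy R).
move=> _ [S _ <-]; rewrite -(min_guesser_score S).
by apply: (is_min_guesser_unlikeliest S m n).2; exists min_guesser.
Qed.

End greedy_min.

(** * The integral giving the constant *)

Section integral_expR_Nexp.
Variable R : realType.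
Local Notation mu := (@lebesgue_measure R).

Lemma is_derive1_cvg (f : R -> R) (x df : R) :
  is_derive x 1 f df -> f t @[t --> x] --> f x.
Proof.
move=> dfx; have /derivable1_diffP : derivable f x 1 by exact: ex_derive.
exact: differentiable_continuous.
Qed.

Lemma cvgr_expRN_mul (a : R) : 0 < a -> expR (- (a * x)) @[x --> +oo] --> (0 : R).
Proof.
move=> a0; apply: (@cvg_comp _ _ _ ( *%R a) (fun x => expR (- x)) _ (pinfty_nbhs R)).
  exact: gt0_cvgMry.
exact: cvgr_expR.
Qed.

Lemma integral_expRN (a : R) :
  (\int[mu]_(t in `[a, +oo[) (expR (- t))%:E = (expR (- a))%:E)%E.
Proof.
have dN (x : R) : is_derive x 1 (fun t : R => - expR (- t)) (expR (- x)).
  by apply: is_derive_eq; rewrite mulrN1 opprK.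
rewrite (@ge0_continuous_FTC2y R (fun t => expR (- t)) (fun t => - expR (- t)) a 0).
- by rewrite EFinN oppeK add0e.
- by move=> x _; exact: expR_ge0.
- by apply: continuous_subspaceT => x; apply: continuous_comp;
    [exact: opp_continuous|exact: continuous_expR].
- by rewrite -oppr0; apply: cvgN; exact: cvgr_expR.
- by move=> x _; exact: ex_derive.
- by apply/cvg_at_right_filter; apply: is_derive1_cvg.
- by move=> x _; rewrite derive1E derive_val.
Qed.

(** The conjunct [0 <= t] matters: the real power of a negative number is a conventional value. *)
Lemma powR_le_root m (s t : R) : (0 < m)%N -> 0 <= s ->
  (s ^+ m <= t) = (0 <= t) && (s <= t `^ m%:R^-1).
Proof.
move=> m0 s0.
have rootK (u : R) : 0 <= u -> (u `^ m%:R^-1) ^+ m = u.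
  by move=> u0; rewrite -powR_mulrn ?powR_ge0// -powRrM mulVf ?powRr1// pnatr_eq0 -lt0n.
apply/idP/andP => [smt|[t0 st]].
  have t0 : 0 <= t by rewrite (le_trans _ smt)// exprn_ge0.
  by split=> //; rewrite -(@ler_pXn2r _ m)// ?nnegrE ?powR_ge0// rootK.
by rewrite -(rootK t t0) lerXn2r ?nnegrE ?powR_ge0.
Qed.

(* Both sides are the integral of exp (- t) over the (s, t) with s^m <= t. *)
Lemma integral_expR_Nexp m : (0 < m)%N ->
  (\int[mu]_(s in `[0%R, +oo[) (expR (- s ^+ m))%:E =
   \int[mu]_(t in `]0%R, +oo[) (t `^ m%:R^-1 * expR (- t))%:E)%E.
Proof.
move=> m0.
pose A : set (R * R) := [set z | 0 <= z.1 /\ z.1 ^+ m <= z.2].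
pose f (z : R * R) : \bar R := ((expR (- z.2))%:E * (\1_A z)%:E)%E.
have mA : measurable A.
  have -> : A = setT `&` [set z | (0 <= z.1) && (z.1 ^+ m <= z.2)].
    by rewrite setTI; apply/seteqP; split => z /= => [[-> ->]|/andP[]].
  pose b (z : R * R) := (0 <= z.1) && (z.1 ^+ m <= z.2).
  rewrite [X in _ `&` X](_ : _ = b @^-1` [set true])//.
  suff mb : measurable_fun setT b by exact: mb.
  by apply: measurable_and; apply: measurable_fun_ler => //;
    apply: measurable_funX => //; exact: measurable_fst.
have mf : measurable_fun setT f.
  apply: emeasurable_funM; apply/measurable_EFinP; last exact: measurable_indic.
  apply: measurableT_comp => //; apply: measurableT_comp => //.
have f0 z : (0 <= f z)%E by rewrite mule_ge0// lee_fin ?expR_ge0.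
have := @fubini_tonelli _ _ _ _ R mu mu f mf f0.
rewrite (_ : \int[mu]_x _ =
    \int[mu]_(s in `[0%R, +oo[) (expR (- s ^+ m))%:E)%E; last first.
  (* For [0 <= s] the section of [A] is [[s ^+ m, +oo[], where [expR (- t)] integrates to
     [expR (- s ^+ m)]. *)
  rewrite [RHS]integral_mkcond; apply: eq_integral => s _.
  rewrite patchE mem_setE in_itv/= andbT; case: (leP 0 s) => s0.
    rewrite -integral_expRN [RHS]integral_mkcond; apply: eq_integral => t _.
    rewrite patchE mem_setE in_itv/= andbT /f indicE; case: ifPn => st.
      by rewrite mem_set ?mule1.
    by rewrite memNset ?mule0// => -[_] /=; exact/negP.
  apply: integral0_eq => t _; rewrite /f indicE memNset ?mule0// => -[/=].
  by rewrite leNgt s0.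
rewrite (_ : \int[mu]_y _ =
    \int[mu]_(t in `]0%R, +oo[) (t `^ m%:R^-1 * expR (- t))%:E)%E => [->//|].
rewrite [RHS]integral_mkcond; apply: eq_integral => t _.
rewrite patchE mem_setE in_itv/= andbT; case: (ltP 0 t) => t0.
  (* For [0 < t] the section runs from 0 to the [m]-th root of [t]; its length multiplies the
     constant [expR (- t)]. *)
  transitivity (\int[mu]_(s in `[0%R, (t `^ m%:R^-1)%R]) (expR (- t))%:E)%E.
    rewrite [RHS]integral_mkcond; apply: eq_integral => s _.
    rewrite patchE mem_setE in_itv/= /f indicE; case: ifPn => [/andP[s0 st]|st].
      by rewrite mem_set ?mule1//=; split=> //=; rewrite powR_le_root// (ltW t0).
    rewrite memNset ?mule0// => -[/= s0]; rewrite powR_le_root// => /andP[_ st'].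
    by move: st; rewrite s0 st'.
  rewrite integral_cst//= lebesgue_measure_itv/= lte_fin powR_gt0//.
  by rewrite -EFinB subr0 -EFinM mulrC.
(* For [t <= 0] the section is contained in the point 0, a null set. *)
transitivity (\int[mu]_(s in `[0%R, 0%R]) (f (s, t)))%E.
  rewrite [RHS]integral_mkcond; apply: eq_integral => s _.
  rewrite patchE mem_setE in_itv/=; case: ifPn => // s0.
  rewrite /f indicE memNset ?mule0// => -[/= s0' st].
  move: s0; rewrite s0'/= -(@ler_pXn2r _ m)// ?nnegrE// expr0n gtn_eqF//=.
  by rewrite (le_trans st).
by rewrite set_itv1 integral_set1.
Qed.

End integral_expR_Nexp.

(** * Derivative of a finite product *)

Lemma is_derive_prod (R : realType) (I : finType) (f df : I -> R -> R) (x : R) :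
  (forall i, is_derive x 1 (f i) (df i x)) ->
  is_derive x 1 (fun t => \prod_i f i t) (\sum_i df i x * \prod_(j | j != i) f j x).
Proof.
move=> dfE.
(* On duplicate-free sequences, [rem] deletes an index just as the condition [j != i] does. *)
suff H (r : seq I) : uniq r ->
    is_derive x 1 (fun t => \prod_(i <- r) f i t)
      (\sum_(i <- r) df i x * \prod_(j <- rem i r) f j x).
  have := H (index_enum I) (index_enum_uniq I); congr is_derive.
  apply: eq_bigr => i _; rewrite rem_filter ?index_enum_uniq// big_filter.
  by congr (_ * _); apply: eq_bigl => j.
elim: r => [_|i r IH /= /andP[ir /IH{}IH]].
  rewrite big_nil (_ : (fun t => _) = cst 1); first exact: is_derive_cst.
  by apply/funext => t; rewrite big_nil.
rewrite (_ : (fun t => _) = f i * (fun t => \prod_(j <- r) f j t)); last first.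
  by apply/funext => t; rewrite big_cons.
apply: is_derive_eq; rewrite big_cons eqxx addrC /GRing.scale/=; congr (_ + _).
  exact: mulrC.
rewrite mulr_sumr [LHS]big_seq [RHS]big_seq; apply: eq_bigr => j jr.
rewrite ifN; last by apply: contraNneq ir => ->.
by rewrite big_cons mulrCA.
Qed.

(** * The first extinction time *)

Section gamma_tail.
Variable R : realType.
Implicit Types (k : nat) (t : R).

(* The survival function of the Gamma(k) distribution. *)
Definition gamma_tail k t : R := expR (- t) * \sum_(j < k) t ^+ j / j`!%:R.

(** The probability that a Poisson variable of mean [t] equals [k]; also the density of Gamma(k + 1)
    at [t]. *)
Definition poisson_weight k t : R := expR (- t) * (t ^+ k / k`!%:R).

Lemma gamma_tail0 t : gamma_tail 0 t = 0.
Proof. by rewrite /gamma_tail big_ord0 mulr0. Qed.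

Lemma gamma_tailS k t : gamma_tail k.+1 t = gamma_tail k t + poisson_weight k t.
Proof. by rewrite /gamma_tail big_ord_recr/= mulrDr. Qed.

Lemma gamma_tail_at0 k : gamma_tail k.+1 0 = 1.
Proof.
rewrite /gamma_tail oppr0 expR0 mul1r big_ord_recl/= expr0 divr1 big1 ?addr0//.
by move=> j _; rewrite exprS !mul0r.
Qed.

Lemma poisson_weight_ge0 k t : 0 <= t -> 0 <= poisson_weight k t.
Proof. by move=> t0; rewrite mulr_ge0 ?expR_ge0// divr_ge0// exprn_ge0. Qed.

Lemma gamma_tail_ge0 k t : 0 <= t -> 0 <= gamma_tail k t.
Proof.
move=> t0; rewrite mulr_ge0 ?expR_ge0// sumr_ge0// => j _.
by rewrite divr_ge0// exprn_ge0.
Qed.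

Lemma is_derive_poisson_weight k t :
  is_derive t 1 (poisson_weight k.+1) (poisson_weight k t - poisson_weight k.+1 t).
Proof.
rewrite /poisson_weight (_ : (fun u : R => _) =
  (k.+1`!%:R)^-1 *: ((fun u => expR (- u)) * (id : R -> R) ^+ k.+1)).
  apply: is_derive_eq; rewrite /GRing.scale/= fctE factS natrM exprS.
  have k0 : k`!%:R != 0 :> R by rewrite pnatr_eq0 -lt0n fact_gt0.
  have k1 : k.+1%:R != 0 :> R by rewrite pnatr_eq0.
  by field; rewrite addrC natr1 k0 k1.
by apply/funext => u; rewrite !fctE mulrA mulrC.
Qed.

(** Differentiation turns each Poisson weight into a difference of consecutive ones, and the sum
    telescopes. *)
Lemma is_derive_gamma_tail k t :
  is_derive t 1 (gamma_tail k.+1) (- poisson_weight k t).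
Proof.
elim: k t => [|k IH] t.
  rewrite (_ : gamma_tail 1 = fun u => expR (- u)); last first.
    by apply/funext => u; rewrite /gamma_tail big_ord1 expr0 divr1 mulr1.
  by apply: is_derive_eq; rewrite /poisson_weight expr0 divr1 mulr1 mulrN1.
rewrite (_ : gamma_tail k.+2 = gamma_tail k.+1 + poisson_weight k.+1); last first.
  by apply/funext => u; rewrite gamma_tailS.
have := is_derive_poisson_weight k t => ?.
by apply: is_derive_eq; rewrite addrA addNr add0r.
Qed.

Lemma gamma_tail_cvg k t : gamma_tail k u @[u --> t] --> gamma_tail k t.
Proof.
case: k => [|k]; last exact: is_derive1_cvg (is_derive_gamma_tail k t).
rewrite (_ : gamma_tail 0 = cst 0); first exact: cvg_cst.
by apply/funext => u; rewrite gamma_tail0.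
Qed.

Lemma gamma_tail_cvgy k : gamma_tail k t @[t --> +oo] --> 0.
Proof.
(* Each power costs only half of the exponential decay. *)
have term j t : 0 <= t -> t ^+ j / j`!%:R <= 2 ^+ j * expR (t / 2).
  move=> t0; have -> : t ^+ j / j`!%:R = 2 ^+ j * ((t / 2) ^+ j / j`!%:R).
    by rewrite mulrA -exprMn [2 * _]mulrC divfK.
  rewrite ler_wpM2l ?exprn_ge0//.
  have t20 : 0 <= t / 2 by rewrite divr_ge0.
  case: j => [|j]; first by rewrite expr0 divr1 (le_trans _ (expR_ge1Dx _))// lerDl.
  have := expR_ge1Dxn j t20; by apply: le_trans; rewrite lerDr.
apply: (@squeeze_cvgr _ _ _ _ (cst 0)
    (fun t => (\sum_(j < k) 2 ^+ j) * expR (- (2^-1 * t)))).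
- near=> t.
  have t0 : 0 <= t by near: t; exact: nbhs_pinfty_ge.
  rewrite gamma_tail_ge0//=.
  have -> : - (2^-1 * t) = - t + t / 2 by field.
  rewrite expRD mulrCA ler_wpM2l ?expR_ge0// mulr_suml ler_sum// => j _.
  exact: term.
- exact: cvg_cst.
- rewrite -[X in _ --> X](mulr0 (\sum_(j < k) 2 ^+ j)).
  by apply: cvgM; [exact: cvg_cst|exact: cvgr_expRN_mul].
Unshelve. all: by end_near. Qed.

End gamma_tail.

(** * The minimal score as an integral of survival probabilities *)

Section all_alive.
Variables (R : realType) (n : nat) (kappa : R).
Hypothesis kappa0 : 0 < kappa.
Implicit Types (d : deck n) (s : R).
Local Notation mu := (@lebesgue_measure R).

(* The probability that no type is extinct at time s / kappa. *)
Definition all_alive d s : R := \prod_i gamma_tail (d i) (s / kappa).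

Lemma all_alive_ge0 d s : 0 <= s -> 0 <= all_alive d s.
Proof.
by move=> s0; apply: prodr_ge0 => i _; rewrite gamma_tail_ge0// divr_ge0// ltW.
Qed.

Lemma all_alive_eq0 d i s : i \notin supp d -> all_alive d s = 0.
Proof.
rewrite supp_gt0 -eqn0Ngt => /eqP di; apply/eqP; apply/prodf_eq0.
by exists i => //; rewrite di gamma_tail0.
Qed.

Lemma all_alive_continuous d : continuous (all_alive d).
Proof.
move=> s; apply: cvg_big => [|i _]; first exact: mul_continuous.
apply: (@cvg_comp _ _ _ (fun t => t / kappa) (gamma_tail (d i))).
  by apply: cvgM; [exact: cvg_id|exact: cvg_cst].
exact: gamma_tail_cvg.
Qed.

Lemma all_alive_remove d i s : i \in supp d ->
  all_alive (remove_card d i) s =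
  gamma_tail (d i).-1 (s / kappa) * \prod_(j | j != i) gamma_tail (d j) (s / kappa).
Proof.
move=> id; rewrite /all_alive (bigD1 i)//= ffunE eqxx subn1; congr (_ * _).
by apply: eq_bigr => j /negbTE ji; rewrite ffunE ji subn0.
Qed.

(** The difference is the probability that type [i] is down to its last card while every other type
    survives. *)
Lemma all_alive_removeB d i s : i \in supp d ->
  all_alive d s - all_alive (remove_card d i) s =
  poisson_weight (d i).-1 (s / kappa) * \prod_(j | j != i) gamma_tail (d j) (s / kappa).
Proof.
move=> id; rewrite all_alive_remove// /all_alive (bigD1 i)//= -mulrBl.
move: id; rewrite supp_gt0; case: (d i) => // k _.
by rewrite gamma_tailS/= addrC addKr.
Qed.

(** Extinction occurs when a type at its last card rings; [kappa^-1] comes from the change of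
    time. *)
Lemma is_derive_all_alive d s : supp d = [set: 'I_n]%SET ->
  is_derive s 1 (all_alive d)
    (- (kappa^-1 * \sum_i (all_alive d s - all_alive (remove_card d i) s))).
Proof.
move=> dT; have di i : (0 < d i)%N by rewrite -supp_gt0 dT finset.inE.
have dg i : is_derive s 1 (fun t => gamma_tail (d i) (t / kappa))
    (- poisson_weight (d i).-1 (s / kappa) / kappa).
  have dk : is_derive s 1 (fun t : R => t / kappa) kappa^-1.
    rewrite (_ : (fun t => _) = kappa^-1 *: (id : R -> R)); last first.
      by apply/funext => t; rewrite mulrC.
    by apply: is_derive_eq; rewrite /GRing.scale/= mulr1.
  have dt : is_derive (s / kappa) 1 (gamma_tail (d i))
      (- poisson_weight (d i).-1 (s / kappa)).
    by rewrite -[X in gamma_tail X](prednK (di i)); exact: is_derive_gamma_tail.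
  exact: (@is_derive1_comp _ _ (fun t => t / kappa) _ _ _ dt dk).
have := @is_derive_prod R _ (fun i t => gamma_tail (d i) (t / kappa))
  (fun i s => - poisson_weight (d i).-1 (s / kappa) / kappa) s dg.
congr is_derive; rewrite mulr_sumr -sumrN; apply: eq_bigr => i _.
by rewrite all_alive_removeB ?dT ?finset.inE// !mulNr mulrAC mulrC.
Qed.

Lemma all_alive_at0 d : supp d = [set: 'I_n]%SET -> all_alive d 0 = 1.
Proof.
move=> dT; rewrite /all_alive big1// => i _; rewrite mul0r.
have : i \in supp d by rewrite dT finset.inE.
by rewrite supp_gt0; case: (d i) => // k _; rewrite gamma_tail_at0.
Qed.

Lemma all_alive_remove_le d i s : 0 <= s ->
  all_alive (remove_card d i) s <= all_alive d s.
Proof.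
move=> s0; have [id|id] := boolP (i \in supp d); last by rewrite remove_card_notin.
have sk0 : 0 <= s / kappa by rewrite divr_ge0// ltW.
rewrite -subr_ge0 all_alive_removeB// mulr_ge0 ?poisson_weight_ge0//.
by apply: prodr_ge0 => j _; exact: gamma_tail_ge0.
Qed.

Lemma all_alive_cvgy d : (0 < n)%N -> all_alive d s @[s --> +oo] --> 0.
Proof.
move=> n0; rewrite [X in _ --> X](_ : 0 = \prod_(i < n) (0 : R)); last first.
  by rewrite prodr_const card_ord expr0n gtn_eqF.
apply: cvg_big => [|i _]; first exact: mul_continuous.
apply: (@cvg_comp _ _ _ (fun t => t / kappa) (gamma_tail (d i)) _ (pinfty_nbhs R)).
  by apply: gt0_cvgMly; rewrite ?invr_gt0.
exact: gamma_tail_cvgy.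
Qed.

Lemma measurable_all_alive d (D : set R) : measurable_fun D (all_alive d).
Proof.
apply: measurable_funTS; apply: continuous_measurable_fun.
exact: all_alive_continuous.
Qed.

(** The integrand is the density of the rescaled first extinction time; survival falls from 1 at 0
    to 0 at infinity. *)
Lemma integral_all_alive_removeB d : (0 < n)%N -> supp d = [set: 'I_n]%SET ->
  (\int[mu]_(s in `[0%R, +oo[)
     (kappa^-1 * \sum_i (all_alive d s - all_alive (remove_card d i) s))%:E = 1)%E.
Proof.
move=> n0 dT; have dN s : is_derive s 1 (fun s => - all_alive d s)
    (kappa^-1 * \sum_i (all_alive d s - all_alive (remove_card d i) s)).
  by have ? := is_derive_all_alive s dT; apply: is_derive_eq; rewrite opprK.
rewrite (@ge0_continuous_FTC2y R _ (fun s => - all_alive d s) 0 0).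
- by rewrite all_alive_at0// EFinN oppeK add0e.
- move=> s s0; rewrite mulr_ge0 ?invr_ge0 ?(ltW kappa0)// sumr_ge0// => i _.
  by rewrite subr_ge0 all_alive_remove_le.
- apply: continuous_subspaceT => s; apply: cvgM; first exact: cvg_cst.
  apply: cvg_big => [|i _]; first exact: add_continuous.
  by apply: cvgB; exact: all_alive_continuous.
- by rewrite -oppr0; apply: cvgN; exact: all_alive_cvgy.
- by move=> s _; exact: ex_derive.
- by apply/cvg_at_right_filter; apply: is_derive1_cvg.
- by move=> s _; rewrite derive1E derive_val.
Qed.

(** Both sides vanish when a type is missing and otherwise satisfy the same recursion, whose
    constant term [kappa] is the integral of the density times [kappa]. *)
Lemma integral_all_alive d : (0 < n)%N ->
  (\int[mu]_(s in `[0%R, +oo[) (all_alive d s)%:E = (kappa * min_score R d)%:E)%E.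
Proof.
move=> n0; elim/deck_ind: d => [|d d0 IH].
  rewrite min_score_empty mulr0 integral0_eq// => s _.
  by rewrite (@all_alive_eq0 _ (Ordinal n0))// supp_gt0 ffunE.
have [[i id]|dT] : (exists i, i \notin supp d) \/ supp d = [set: 'I_n]%SET.
  have [/eqP|] := boolP (supp d == [set: 'I_n]%SET); first by right.
  rewrite finset.eqEsubset finset.subsetT => /fintype.subsetPn[i _ id].
  by left; exists i.
  rewrite (min_score_eq0 _ id) mulr0 integral0_eq// => s _.
  by rewrite (all_alive_eq0 _ id).
have nR0 : n%:R != 0 :> R by rewrite pnatr_eq0 -lt0n.
pose f s := kappa^-1 * \sum_i (all_alive d s - all_alive (remove_card d i) s).
have f0 s : 0 <= s -> 0 <= f s.
  move=> s0; rewrite mulr_ge0 ?invr_ge0 ?(ltW kappa0)// sumr_ge0// => i _.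
  by rewrite subr_ge0 all_alive_remove_le.
have mf : measurable_fun (`[0, +oo[%classic : set R) (EFin \o f).
  apply/measurable_EFinP; apply: measurable_funM => //.
  by apply: measurable_sum => i; apply: measurable_funB; exact: measurable_all_alive.
(* Solving the definition of [f] for [all_alive d s] gives the recursion of [min_score] under the
   integral sign. *)
have dE s : (all_alive d s)%:E = ((n%:R^-1)%:E * (kappa%:E * (f s)%:E +
    \sum_(i < n) (all_alive (remove_card d i) s)%:E))%E.
  rewrite sumEFin -!EFinM; congr (_%:E); rewrite /f mulVKf ?gt_eqF//.
  by rewrite sumrB addrNK sumr_const card_ord -[all_alive d s *+ n]mulr_natl mulKf.
under eq_integral do rewrite dE.
have mE i D : measurable_fun D (EFin \o all_alive (remove_card d i)).
  by apply/measurable_EFinP; exact: measurable_all_alive.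
have mS D : measurable_fun D
    (fun s => \sum_(i < n) (all_alive (remove_card d i) s)%:E)%E.
  by apply: emeasurable_sum => i; exact: mE.
have in0 (s : R) : `[0, +oo[%classic s -> 0 <= s by rewrite /= in_itv/= andbT.
have S0 (s : R) : `[0, +oo[%classic s ->
    (0 <= \sum_(i < n) (all_alive (remove_card d i) s)%:E)%E.
  by move=> /in0 s0; apply: sume_ge0 => i _; rewrite lee_fin all_alive_ge0.
have kf0 (s : R) : `[0, +oo[%classic s -> (0 <= kappa%:E * (f s)%:E)%E.
  by move=> /in0 s0; rewrite -EFinM lee_fin mulr_ge0 ?f0// ltW.
have mkf : measurable_fun (`[0, +oo[%classic : set R) (fun s => kappa%:E * (f s)%:E)%E.
  exact: emeasurable_funM.
rewrite ge0_integralZl_EFin//; last 2 first.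
- by move=> s s0; rewrite adde_ge0 ?kf0 ?S0.
- by apply: emeasurable_funD; [exact: mkf|exact: mS].
rewrite ge0_integralD//; last exact: mS.
rewrite ge0_integralZl_EFin//; last 2 first.
- by move=> s /in0 s0; rewrite lee_fin f0.
- exact: ltW.
rewrite integral_all_alive_removeB// mule1 ge0_integral_sum//; last 2 first.
- by move=> i; exact: mE.
- by move=> i s /in0 s0; rewrite lee_fin all_alive_ge0.
under eq_bigr => i _ do rewrite IH ?dT ?finset.inE//.
rewrite sumEFin -EFinD -EFinM -mulr_sumr; congr (_%:E).
by rewrite -[X in X + _]mulr1 -mulrDr -min_score_rec// mulrCA mulKf.
Qed.

End all_alive.

(** * Bounds on the Gamma survival function *)

Section gamma_tail_bounds.
Variable R : realType.
Implicit Types (f df : R -> R) (a x t s : R).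

Lemma le_is_derive_le0 f df a x : (forall y : R, is_derive y 1 f (df y)) ->
  (forall y, a <= y -> df y <= 0) -> a <= x -> f x <= f a.
Proof.
move=> fdf df0 ax.
apply: (@ler0_derive1_le_cc _ f a x _ _ _ _ _ _ _ ax).
- by move=> y _; have ? := fdf y; exact: ex_derive.
- move=> y; rewrite in_itv/= => /andP[/ltW ay _].
  by have ? := fdf y; rewrite derive1E derive_val df0.
- by apply: continuous_subspaceT => y; exact: is_derive1_cvg (fdf y).
- by rewrite in_itv/= lexx ax.
- by rewrite in_itv/= lexx ax.
Qed.

Lemma gamma_tail_le1 k t : 0 <= t -> gamma_tail k t <= 1.
Proof.
case: k => [|k] t0; first by rewrite gamma_tail0 ler01.
rewrite -(gamma_tail_at0 R k).
apply: (le_is_derive_le0 (is_derive_gamma_tail k)) => // y y0.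
by rewrite oppr_le0 poisson_weight_ge0.
Qed.

Lemma gamma_tail_le k t : 0 <= t -> gamma_tail k t <= 1 - poisson_weight k t.
Proof. by move=> t0; rewrite lerBrDr -gamma_tailS gamma_tail_le1. Qed.

(** The sum of [gamma_tail k.+1 t] and the subtracted term is 1 at 0 and has derivative
    [t^k / k! (1 - e^-t)], which is nonnegative for [t >= 0]. *)
Lemma gamma_tail_ge k t : 0 <= t -> 1 - t ^+ k.+1 / k.+1`!%:R <= gamma_tail k.+1 t.
Proof.
move=> t0; pose f := - (gamma_tail k.+1 + (k.+1`!%:R)^-1 *: (id : R -> R) ^+ k.+1).
have df (y : R) : is_derive y 1 f (- (y ^+ k / k`!%:R * (1 - expR (- y)))).
  have ? := is_derive_gamma_tail k y.
  apply: is_derive_eq; rewrite /GRing.scale/= ?fctE factS natrM /poisson_weight.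
  have k0 : k`!%:R != 0 :> R by rewrite pnatr_eq0 -lt0n fact_gt0.
  have k1 : k.+1%:R != 0 :> R by rewrite pnatr_eq0.
  by field; rewrite addrC natr1 k0 k1.
have : f t <= f 0.
  apply: (le_is_derive_le0 df) => // y y0.
  by rewrite oppr_le0 mulr_ge0 ?divr_ge0 ?exprn_ge0// subr_ge0 expR_le1 oppr_le0.
rewrite /f !fctE gamma_tail_at0 expr0n/= scaler0 addr0 lerN2 /GRing.scale/=.
by rewrite lerBlDr [X in _ + X]mulrC.
Qed.

(** The value of [poisson_weight k.+1] at 1; this constant serves as decay rate on both sides of
    [t = 1]. *)
Definition gamma_rate k : R := expR (- 1) / k.+1`!%:R.

Lemma gamma_rate_gt0 k : 0 < gamma_rate k.
Proof. by rewrite divr_gt0 ?expR_gt0// ltr0n fact_gt0. Qed.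

Lemma gamma_tail_le_small k t : 0 <= t -> t <= 1 ->
  gamma_tail k.+1 t <= expR (- (gamma_rate k * t ^+ k.+1)).
Proof.
move=> t0 t1; apply: le_trans (gamma_tail_le _ t0) _; apply: le_trans (expR_ge1Dx _).
rewrite lerD2l lerN2 /gamma_rate /poisson_weight mulrAC -mulrA.
by rewrite ler_wpM2r ?divr_ge0 ?exprn_ge0// ler_expR lerN2.
Qed.

(** The product [expR (c * t) * gamma_tail k.+1 t] is nonincreasing for [t >= 1], and at most 1 at
    [t = 1] by the bound for small [t]. *)
Lemma gamma_tail_le_large k t : 1 <= t ->
  gamma_tail k.+1 t <= expR (- (gamma_rate k * t)).
Proof.
move=> t1; set c := gamma_rate k.
pose f := (fun u => expR (c * u)) * gamma_tail k.+1.
have df (y : R) : is_derive y 1 f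
    (expR (c * y) * (c * gamma_tail k.+1 y - poisson_weight k y)).
  have ? := is_derive_gamma_tail k y.
  have dc : is_derive y 1 (fun u => expR (c * u)) (c * expR (c * y)).
    have dl : is_derive y 1 (fun u : R => c * u) c.
      rewrite (_ : (fun u : R => c * u) = c *: (id : R -> R))//.
      by apply: is_derive_eq; rewrite /GRing.scale/= mulr1.
    have := @is_derive1_comp _ _ (fun u : R => c * u) _ _ _ (is_derive_expR (c * y)) dl.
    by congr is_derive; rewrite mulrC.
  by apply: is_derive_eq; rewrite /GRing.scale/=; ring.
have : f t <= f 1.
  apply: (le_is_derive_le0 df) => // y y1.
  have y0 := le_trans ler01 y1.
  rewrite pmulr_rle0 ?expR_gt0// subr_le0 /poisson_weight /gamma_tail mulrCA.
  rewrite ler_wpM2l ?expR_ge0// /c /gamma_rate factS natrM.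
  (* Since [y >= 1], each of the [k.+1] terms is at most [y ^+ k]; the factor [k.+1] in the
     denominator of [c] compensates their number. *)
  apply: (@le_trans _ _ ((k.+1%:R * k`!%:R)^-1 * (k.+1%:R * y ^+ k))).
    apply: ler_pM.
    - by rewrite divr_ge0 ?expR_ge0// -natrM.
    - by rewrite sumr_ge0// => j _; rewrite divr_ge0// exprn_ge0.
    - by rewrite ler_piMl ?invr_ge0 -?natrM// expR_le1 lerN10.
    - rewrite -[k.+1 in leRHS]card_ord mulr_natl -sumr_const ler_sum// => j _.
      rewrite (@le_trans _ _ (y ^+ j))//.
        by rewrite ler_piMr ?exprn_ge0// invf_le1 ?ler1n ?ltr0n ?fact_gt0.
      by rewrite ler_weXn2l// -ltnS.
  by rewrite mulrC -mulf_div divff ?pnatr_eq0// mul1r.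
rewrite /f !fctE mulr1 => ft.
have : expR c * gamma_tail k.+1 1 <= 1.
  rewrite -[leRHS](expRxMexpNx_1 c) ler_wpM2l ?expR_ge0//.
  have := @gamma_tail_le_small k 1 ler01 (lexx _).
  by rewrite expr1n mulr1.
move=> /(le_trans ft); rewrite expRN -ler_pdivlMl ?expR_gt0// mulr1.
exact.
Qed.

End gamma_tail_bounds.

(** * Asymptotics of the worst score *)

Section scaling.
Variables (R : realType) (k : nat).
Local Notation m := k.+1.
Local Notation mu := (@lebesgue_measure R).
Implicit Types (s : R) (n : nat).

(* At t = s / time_scale n, the quantity n t^m / m! is s^m. *)
Definition time_scale n : R := (n%:R / m`!%:R) `^ m%:R^-1.

Lemma time_scale_gt0 n : (0 < n)%N -> 0 < time_scale n.
Proof. by move=> n0; rewrite powR_gt0// divr_gt0// ltr0n ?fact_gt0. Qed.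

Lemma time_scaleX n : time_scale n ^+ m = n%:R / m`!%:R.
Proof.
by rewrite -powR_mulrn ?powR_ge0// -powRrM mulVf ?pnatr_eq0// powRr1// divr_ge0.
Qed.

Lemma time_scale_le n : (0 < n)%N -> time_scale n <= n%:R.
Proof.
move=> n0; rewrite -(@ler_pXn2r _ m)// ?nnegrE ?powR_ge0// time_scaleX.
rewrite (@le_trans _ _ n%:R)//.
  by rewrite ler_piMr// invf_le1 ?ler1n ?ltr0n ?fact_gt0.
by rewrite -natrX ler_nat -[leqLHS]expn1 leq_pexp2l.
Qed.

Lemma time_scale_cvgy : time_scale n @[n --> \oo] --> (+oo : set_system R).
Proof.
apply/cvgryPge => A; near=> n.
have [A0|A0] := leP A 0; first by rewrite (le_trans A0)// powR_ge0.
rewrite -(@ler_pXn2r _ m)// ?nnegrE ?powR_ge0 ?(ltW A0)// time_scaleX.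
rewrite ler_pdivlMr ?ltr0n ?fact_gt0//.
by near: n; exact: nbhs_infty_ger.
Unshelve. all: by end_near. Qed.

Lemma scaledX n s : (0 < n)%N ->
  (s / time_scale n) ^+ m / m`!%:R = s ^+ m / n%:R.
Proof.
move=> n0; rewrite expr_div_n time_scaleX invf_div mulrA mulrAC mulfK//.
Qed.

(** An integrable bound uniform in [n]. For small arguments the exponent is [- c m! s^m], and
    [m! s^m >= s - 1]; for large ones it is [- c n s / time_scale n], and [time_scale n <= n]. *)
Lemma scaled_tail_le n s : (0 < n)%N -> 0 <= s ->
  gamma_tail m (s / time_scale n) ^+ n <=
  expR (gamma_rate R k) * expR (- (gamma_rate R k * s)).
Proof.
move=> n0 s0; have c0 := gamma_rate_gt0 R k; set c := gamma_rate R k in c0 *.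
have K0 := time_scale_gt0 n0; have nR0 : 0 < n%:R :> R by rewrite ltr0n.
have t0 : 0 <= s / time_scale n by rewrite divr_ge0// ltW.
rewrite -expRD; have [t1|t1] := leP (s / time_scale n) 1.
  apply: le_trans (lerXn2r n _ _ (gamma_tail_le_small k t0 t1)) _;
    rewrite ?nnegrE ?expR_ge0 ?gamma_tail_ge0//.
  have key : (s / time_scale n) ^+ m * n%:R = m`!%:R * s ^+ m.
    have := scaledX s n0 => /(canRL (divfK _)) ->; last first.
      by rewrite pnatr_eq0 -lt0n fact_gt0.
    by field; rewrite gt_eqF.
  rewrite -expRM_natr ler_expR -/c mulNr -mulrA key -subr_ge0.
  rewrite (_ : _ - _ = c * (1 + m`!%:R * s ^+ m - s)); last by ring.
  rewrite mulr_ge0 ?(ltW c0)// subr_ge0; have [s1|s1] := leP s 1.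
    by rewrite ler_wpDr// mulr_ge0// exprn_ge0.
  rewrite ler_wpDl// (@le_trans _ _ (s ^+ m))//; first by rewrite ler_eXnr// ltW.
  by rewrite ler_peMl ?exprn_ge0// ler1n fact_gt0.
apply: le_trans (lerXn2r n _ _ (gamma_tail_le_large k (ltW t1))) _;
  rewrite ?nnegrE ?expR_ge0 ?gamma_tail_ge0//.
rewrite -expRM_natr ler_expR -/c ler_wpDl ?(ltW c0)// mulNr lerN2.
rewrite -[leRHS]mulrA ler_pM2l//.
by rewrite mulrAC -mulrA ler_peMr// ler_pdivlMr// mul1r time_scale_le.
Qed.

(** With [x = s^m / n] and [t = s / time_scale n], the survival probability lies between [1 - x] and
    [1 - e^-t x]; exponential bounds on the [n]-th powers of these squeeze the limit. *)
Lemma scaled_tail_cvg s : 0 <= s ->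
  gamma_tail m (s / time_scale n) ^+ n @[n --> \oo] --> expR (- s ^+ m).
Proof.
move=> s0.
have tK : s / time_scale n @[n --> \oo] --> (0 : R).
  rewrite -[X in _ --> X](mulr0 s); apply: cvgM; first exact: cvg_cst.
  apply/gtr0_cvgV0; last exact: time_scale_cvgy.
  by near=> n; apply: time_scale_gt0; near: n; exact: nbhs_infty_gt.
have sn : s ^+ m / n%:R @[n --> \oo] --> (0 : R).
  rewrite -[X in _ --> X](mulr0 (s ^+ m)); apply: cvgM; first exact: cvg_cst.
  apply/gtr0_cvgV0; last exact: cvgr_idn.
  by near=> n; rewrite ltr0n; near: n; exact: nbhs_infty_gt.
apply: (@squeeze_cvgr _ _ _ _
  (fun n => expR (- (s ^+ m / (1 - s ^+ m / n%:R))))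
  (fun n => expR (- (expR (- (s / time_scale n)) * s ^+ m)))).
- near=> n.
  have n0 : (0 < n)%N by near: n; exact: nbhs_infty_gt.
  have nR0 : 0 < n%:R :> R by rewrite ltr0n.
  have t0 : 0 <= s / time_scale n by rewrite divr_ge0// ltW// time_scale_gt0.
  have x1 : s ^+ m / n%:R < 1.
    rewrite ltr_pdivrMr// mul1r; near: n; exact: nbhs_infty_gtr.
  have x0 : 0 <= s ^+ m / n%:R by rewrite divr_ge0// exprn_ge0.
  have x1' : 0 < 1 - s ^+ m / n%:R by rewrite subr_gt0.
  apply/andP; split.
    rewrite (_ : - _ = - (s ^+ m / n%:R / (1 - s ^+ m / n%:R)) * n%:R); last first.
      field; rewrite gt_eqF//= subr_eq0; move: x1; rewrite ltr_pdivrMr// mul1r.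
      by move=> /lt_eqF; rewrite eq_sym => ->.
    rewrite expRM_natr lerXn2r ?nnegrE ?expR_ge0 ?gamma_tail_ge0//.
    apply: le_trans (gamma_tail_ge k t0); rewrite scaledX//.
    (* The inverse of [1 - x] is [1 + x / (1 - x)], hence at most [expR (x / (1 - x))]. *)
    rewrite expRN -[leRHS]invrK lef_pV2 ?posrE ?expR_gt0 ?invr_gt0//.
    rewrite [leLHS](_ : _ = 1 + s ^+ m / n%:R / (1 - s ^+ m / n%:R)).
      exact: expR_ge1Dx.
    apply: (mulIf (lt0r_neq0 x1')); rewrite mulVf ?lt0r_neq0// mulrDl.
    by rewrite divfK ?lt0r_neq0// mul1r subrK.
  apply: le_trans (lerXn2r n _ _ (gamma_tail_le _ t0)) _.
  - by rewrite nnegrE gamma_tail_ge0.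
  - by rewrite nnegrE (le_trans _ (gamma_tail_le _ t0))// gamma_tail_ge0.
  rewrite /poisson_weight scaledX//.
  rewrite [X in _ <= expR X](_ : _ =
      - (expR (- (s / time_scale n)) * (s ^+ m / n%:R)) * n%:R); last first.
    by rewrite mulNr -mulrA divfK ?gt_eqF.
  rewrite expRM_natr lerXn2r ?nnegrE ?expR_ge0 ?expR_ge1Dx//.
  by rewrite subr_ge0 mulr_ile1 ?expR_ge0 ?expR_le1 ?oppr_le0// ltW.
- apply: (@cvg_comp _ _ _ _ expR _ (nbhs (- s ^+ m))); last exact: continuous_expR.
  apply: cvgN; rewrite -[X in _ --> X]mulr1; apply: cvgM; first exact: cvg_cst.
  rewrite -[X in _ --> X]invr1; apply: cvgV; first exact: oner_neq0.
  by rewrite -[X in _ --> X](subr0 1); apply: cvgB => //; exact: cvg_cst.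
- apply: (@cvg_comp _ _ _ _ expR _ (nbhs (- s ^+ m))); last exact: continuous_expR.
  apply: cvgN; rewrite -[X in _ --> X]mul1r; apply: cvgM; last exact: cvg_cst.
  rewrite -(expR0 R) -[X in expR X]oppr0.
  apply: (@cvg_comp _ _ _ _ expR _ (nbhs (- (0 : R)))); last exact: continuous_expR.
  exact: cvgN.
Unshelve. all: by end_near. Qed.

End scaling.

(** * Dominated convergence and the asymptotic constant *)

Section min_score_asymp.
Variables (R : realType) (k : nat).
Local Notation m := k.+1.
Local Notation mu := (@lebesgue_measure R).

Local Notation halfline := (`[0, +oo[%classic : set R).

Let dominating (s : R) := expR (gamma_rate R k) * expR (- (gamma_rate R k * s)).

(** Up to a constant factor, this is the exponential density of rate [gamma_rate R k]. *)
Lemma integrable_dominating : mu.-integrable halfline (EFin \o dominating).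
Proof.
have c0 := gamma_rate_gt0 R k.
have iE : mu.-integrable halfline (EFin \o exponential_pdf (gamma_rate R k)).
  by have := integrable_exponential_pdf c0; exact: integrableS.
have : mu.-integrable halfline (fun s => (expR (gamma_rate R k) / gamma_rate R k)%:E *
    (exponential_pdf (gamma_rate R k) s)%:E)%E by exact: integrableZl.
apply: eq_integrable => // s /[!inE]; rewrite /= in_itv/= andbT => s0.
rewrite exponential_pdfE// -EFinM; congr (_%:E).
by rewrite /dominating mulNr mulrA divfK ?gt_eqF.
Qed.

Lemma integral_scaled_tail n : (0 < n)%N ->
  (\int[mu]_(s in halfline) (gamma_tail m (s / time_scale R k n) ^+ n)%:E =
   (time_scale R k n * min_score R (full_deck m n))%:E)%E.
Proof.
move=> n0; rewrite -(integral_all_alive (time_scale_gt0 R k n0) _ n0).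
apply: eq_integral => s _; congr (_%:E); rewrite /all_alive.
by under eq_bigr do rewrite ffunE; rewrite prodr_const card_ord.
Qed.

Lemma measurable_expR_Nexp (D : set R) :
  measurable_fun D (fun s => (expR (- s ^+ m))%:E).
Proof.
apply/measurable_EFinP; apply: measurableT_comp => //.
by apply: measurableT_comp => //; exact: measurable_funX.
Qed.

(** The shift to [n.+1] avoids the scale 0 at [n = 0]. Integrability of the limit is recorded to
    make the Gamma integral finite. *)
Lemma cvg_integral_scaled_tail :
  mu.-integrable halfline (fun s => (expR (- s ^+ m))%:E) /\
  (\int[mu]_(s in halfline) (gamma_tail m (s / time_scale R k n.+1) ^+ n.+1)%:E
    @[n --> \oo] --> \int[mu]_(s in halfline) (expR (- s ^+ m))%:E)%E.
Proof.
have mf n : measurable_fun halfline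
    (fun s => (gamma_tail m (s / time_scale R k n.+1) ^+ n.+1)%:E).
  apply/measurable_EFinP/measurable_funX/measurable_funTS.
  apply: continuous_measurable_fun => s.
  apply: (@cvg_comp _ _ _ (fun t => t / time_scale R k n.+1) (gamma_tail m)).
    by apply: cvgM; [exact: cvg_id|exact: cvg_cst].
  exact: gamma_tail_cvg.
have in0 (s : R) : halfline s -> 0 <= s by rewrite /= in_itv/= andbT.
have [] := @dominated_convergence _ _ _ mu halfline (measurable_itv _)
  (fun n s => (gamma_tail m (s / time_scale R k n.+1) ^+ n.+1)%:E)
  (fun s => (expR (- s ^+ m))%:E) (EFin \o dominating) mf
  (@measurable_expR_Nexp halfline).
- apply: aeW => s /in0 s0; apply: cvg_EFin; first exact: nearW.
  have := @scaled_tail_cvg R k s s0; rewrite -cvg_shiftS.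
  exact.
- exact: integrable_dominating.
- apply: aeW => s n /in0 s0; rewrite /= lee_fin ger0_norm.
    exact: scaled_tail_le.
  by rewrite exprn_ge0// gamma_tail_ge0// divr_ge0// powR_ge0.
- by [].
Qed.

(** [Rintegral] takes the finite part of the extended integral, so finiteness is needed to recover
    it. *)
Lemma GammaE : (Gamma (1 + m%:R^-1) : R)%:E =
  (\int[mu]_(s in halfline) (expR (- s ^+ m))%:E)%E.
Proof.
have [ig _] := cvg_integral_scaled_tail.
rewrite -[RHS]fineK; last exact: integrable_fin_num.
by rewrite integral_expR_Nexp// /Gamma /Rintegral addrAC subrr add0r.
Qed.

(** On the unit interval, [expR (- s ^+ m)] is at least [expR (- 1)]. *)
Lemma Gamma_gt0 : 0 < Gamma (1 + m%:R^-1) :> R.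
Proof.
rewrite -lte_fin GammaE.
apply: (@lt_le_trans _ _ (\int[mu]_(s in `[0%R, 1%R]) (cst (expR (- 1))%:E s)))%E.
  rewrite integral_cst//= lebesgue_measure_itv/= lte_fin ltr01 oppr0 adde0 mule1.
  by rewrite lte_fin expR_gt0.
apply: (@le_trans _ _ (\int[mu]_(s in `[0%R, 1%R]) (expR (- s ^+ m))%:E)%E).
  apply: ge0_le_integral => //=.
  - exact: measurable_expR_Nexp.
  - move=> s; rewrite in_itv/= => /andP[s0 s1].
    by rewrite lee_fin ler_expR lerN2 exprn_ile1.
apply: ge0_subset_integral => //=.
- exact: measurable_expR_Nexp.
- by move=> s; rewrite /= !in_itv/= => /andP[-> _].
Qed.

Lemma min_score_full_asymp :
  asymp_equiv (fun n => min_score R (full_deck m n))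
    (fun n => Gamma (1 + m%:R^-1) * m`!%:R `^ (m%:R^-1) * n%:R `^ (- m%:R^-1)).
Proof.
have G0 := Gamma_gt0; have [_] := cvg_integral_scaled_tail; rewrite -GammaE => cG.
have cG' : (time_scale R k n.+1 * min_score R (full_deck m n.+1)) @[n --> \oo] -->
    (Gamma (1 + m%:R^-1) : R).
  move: cG; under eq_fun do rewrite integral_scaled_tail//.
  exact: fine_cvg.
have : time_scale R k n.+1 * min_score R (full_deck m n.+1) / Gamma (1 + m%:R^-1)
    @[n --> \oo] --> (Gamma (1 + m%:R^-1) / Gamma (1 + m%:R^-1) : R).
  by apply: cvgM => //; exact: cvg_cst.
rewrite divff ?lt0r_neq0// /asymp_equiv -[X in _ -> X]cvg_shiftS.
apply: cvg_trans; apply: near_eq_cvg; near=> n.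
(* The scale is the inverse of [m!^(1/m) n^(-1/m)], so the two quotients agree. *)
rewrite /= /time_scale powRM ?invr_ge0// powRN -[m`!%:R^-1]powR_inv1//.
rewrite powRAC powR_inv1 ?powR_ge0//.
have n0 : n.+1%:R `^ m%:R^-1 != 0 :> R by rewrite gt_eqF// powR_gt0.
have m0 : m`!%:R `^ m%:R^-1 != 0 :> R.
  by rewrite gt_eqF// powR_gt0// ltr0n fact_gt0.
by field; rewrite n0 m0 (lt0r_neq0 G0).
Unshelve. all: by end_near. Qed.

End min_score_asymp.

Theorem theorem1p4 (R : realType) (m : nat) (m_ge1 : (1 <= m)%N) :
  (exists a : nat -> R,
     (forall n : nat, (1 <= n)%N ->
        is_minmax m n (a n) /\ is_max_guesser m n (greedy R) (a n)) /\
     asymp_equiv a (fun n => ln n%:R)) /\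
  (exists b : nat -> R,
     (forall n : nat, (1 <= n)%N ->
        is_maxmin m n (b n) /\ is_min_guesser m n (greedy R) (b n)) /\
     asymp_equiv b
       (fun n => Gamma (1 + m%:R^-1) * m`!%:R `^ (m%:R^-1)
                 * n%:R `^ (- m%:R^-1))).
Proof.
split.
  exists (fun n => max_score R (full_deck m n)); split => [n _|].
    by split; [exact: is_minmax_max_score|exact: is_max_guesser_greedy].
  exact: max_score_full_asymp.
exists (fun n => min_score R (full_deck m n)); split => [n _|].
  by split; [exact: is_maxmin_min_score|exact: is_min_guesser_greedy].
by case: m m_ge1 => // k _; exact: min_score_full_asymp.
Qed.
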